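(* Let $\vdash$ be an equivalential finitary logic with a partition function and a set of inconsistency terms, and let $\langle\mathbf{A},F\rangle$ be a matrix. The following are equivalent: (i) $\langle\mathbf{A},F\rangle\in\mathsf{Mod}^{\mathrm{Su}}(\vdash^{l})$; (ii) there is a directed system of matrices $X$, all of whose matrices belong to $\mathsf{Mod}^{*}(\vdash)$ and at most one of which is trivial, such that $\langle\mathbf{A},F\rangle=\mathrm{PL}(X)$.
   Context: Fix an algebraic language without constant symbols; $\mathrm{Var}(\varphi)$ is the set of variables of $\varphi$. A logic is a substitution-invariant consequence relation; finitary if every consequence follows from a finite subset of premises. The left variable inclusion companion: $\Gamma\vdash^{l}\varphi$ iff there is $\Gamma'\subseteq\Gamma$ with $\bigcup_{\gamma\in\Gamma'}\mathrm{Var}(\gamma)\subseteq\mathrm{Var}(\varphi)$ and $\Gamma'\vdash\varphi$. A matrix $\langle\mathbf{A},F\rangle$ is trivial if $F=A$; it is a model of a logic if $\Gamma\vdash\varphi$ and $h[\Gamma]\subseteq F$ (homomorphism $h$ from the formula algebra) imply $h(\varphi)\in F$; $F$ is then a filter. $\Omega^{\mathbf{A}}F$ is the largest congruence compatible with $F$; the Suszko congruence w.r.t. a logic is the intersection of $\Omega^{\mathbf{A}}G$ over filters $G\supseteq F$ of that logic. $\mathsf{Mod}^{*}(\vdash)$ (resp. $\mathsf{Mod}^{\mathrm{Su}}(\vdash)$) is the class of models of $\vdash$ whose Leibniz (resp. Suszko) congruence is the identity; $\mathrm{Alg}(\vdash)$ is the class of algebraic reducts of $\mathsf{Mod}^{\mathrm{Su}}(\vdash)$.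 $\vdash$ is equivalential if there is a set of formulas $\Delta(x,y)$ such that for every model $\langle\mathbf{A},F\rangle$ and $a,b\in A$: $\langle a,b\rangle\in\Omega^{\mathbf{A}}F$ iff $\Delta^{\mathbf{A}}(a,b)\subseteq F$. A set $\Sigma$ of formulas is a set of inconsistency terms if $\sigma[\Sigma]\vdash\varphi$ for every substitution $\sigma$ and formula $\varphi$. A binary operation $\cdot$ is a partition function on $\mathbf{A}$ if for all $a,b,c$ and basic operations $g$ of arity $n\ge1$: $a\cdot a=a$; $a\cdot(b\cdot c)=(a\cdot b)\cdot c$; $a\cdot(b\cdot c)=a\cdot(c\cdot b)$; $g(a_1,\dots,a_n)\cdot b=g(a_1\cdot b,\dots,a_n\cdot b)$; $b\cdot g(a_1,\dots,a_n)=b\cdot a_1\cdot\ldots\cdot a_n$; $\vdash$ has a partition function if some formula $x\cdot y$ in which both $x,y$ occur satisfies $x\vdash x\cdot y$ and is a partition function on every $\mathbf{A}\in\mathrm{Alg}(\vdash)$. A directed system of matrices: semilattice $\langle I,\vee\rangle$ (order $i\le j$ iff $i\vee j=j$), matrices $\langle\mathbf{A}_i,F_i\rangle$ with pairwise disjoint universes, homomorphisms $f_{ij}\colon\mathbf{A}_i\to\mathbf{A}_j$ ($i\le j$) with $f_{ij}[F_i]\subseteq F_j$, $f_{ii}=\mathrm{id}$, $f_{ik}=f_{jk}\circ f_{ij}$; its Płonka sum $\mathrm{PL}(X)$ is $\langle\mathbf{B},\bigcup_iF_i\rangle$, $\mathbf{B}$ with universe $\bigcup_iA_i$ and $f^{\mathbf{B}}(a_1,\dots,a_n)=f^{\mathbf{A}_j}(f_{i_1j}(a_1),\dots,f_{i_nj}(a_n))$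 for $a_k\in A_{i_k}$, $j=i_1\vee\dots\vee i_n$. *)

(* Defs.v *)
From mathcomp Require Import all_boot.
From mathcomp Require Import mathcomp_extra boolp classical_sets functions cardinality.

Set Implicit Arguments.
Unset Strict Implicit.
Unset Printing Implicit Defensive.

Local Open Scope classical_set_scope.

(* There are no constant symbols: [s] has arity [(arity_pred s).+1]. *)
Record signature := Signature {
  symbol :> Type;
  arity_pred : symbol -> nat }.

Definition arity (S : signature) (s : S) : nat := (arity_pred s).+1.

Record algebra (S : signature) := Algebra {
  carrier :> Type;
  carrier_inhabited : inhabited carrier;
  op : forall s : S, ('I_(arity s) -> carrier) -> carrier }.

Arguments op {S} a s _.

Definition hom (S : signature) (A B : algebra S) (h : A -> B) : Prop :=
  forall (s : S) (a : 'I_(arity s) -> A), h (op A s a) = op B s (h \o a).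

(* The variables are indexed by [nat]. *)
Inductive form (S : signature) : Type :=
| Var : nat -> form S
| App : forall s : S, ('I_(arity s) -> form S) -> form S.

Arguments Var {S} _.
Arguments App {S} s _.

Definition Fm (S : signature) : algebra S := Algebra (inhabits (Var 0)) (@App S).

Fixpoint vars (S : signature) (phi : form S) : set nat :=
  match phi with
  | Var x => [set x]
  | App s t => \bigcup_(k in [set: 'I_(arity s)]) vars (t k)
  end.

Fixpoint eval (S : signature) (A : algebra S) (v : nat -> A) (phi : form S) : A :=
  match phi with
  | Var x => v x
  | App s t => op A s (fun k => eval v (t k))
  end.

Lemma eval_hom (S : signature) (A : algebra S) (v : nat -> A) :
  hom (eval v : Fm S -> A).
Proof. by []. Qed.

Lemma hom_eval (S : signature) (A : algebra S) (h : Fm S -> A) :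
  hom h -> h = eval (h \o Var).
Proof.
move=> hh; apply: funext; elim=> //= s t IH.
rewrite (hh s t); congr (op A s _); exact: funext.
Qed.

(* For [phi] in the variables [x = Var 0] and [y = Var 1],
   [eval (val2 a b) phi] is the value of the term function of [phi] at [a, b]. *)
Definition val2 (A : Type) (a b : A) : nat -> A :=
  fun n => if n is 0 then a else b.

(* Monotonicity follows from [entails_refl] and [entails_cut]. *)
Record logic (S : signature) := Logic {
  entails :> set (form S) -> form S -> Prop;
  entails_refl : forall (Gamma : set (form S)) phi, Gamma phi -> entails Gamma phi;
  entails_cut : forall (Gamma Delta : set (form S)) phi,
    (forall delta, Delta delta -> entails Gamma delta) ->
    entails Delta phi -> entails Gamma phi;
  entails_subst : forall sigma : Fm S -> Fm S, hom sigma ->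
    forall Gamma phi, entails Gamma phi -> entails (sigma @` Gamma) (sigma phi) }.

Definition finitary (S : signature) (L : logic S) : Prop :=
  forall Gamma phi, L Gamma phi ->
    exists Delta, [/\ Delta `<=` Gamma, finite_set Delta & L Delta phi].

Definition lcomp_entails (S : signature) (L : logic S)
    (Gamma : set (form S)) (phi : form S) : Prop :=
  exists Gamma', [/\ Gamma' `<=` Gamma,
    \bigcup_(gamma in Gamma') vars gamma `<=` vars phi & L Gamma' phi].

Lemma vars_subst (S : signature) (sigma : Fm S -> Fm S) (hs : hom sigma) (phi : form S) :
  vars (sigma phi) = \bigcup_(x in vars phi) vars (sigma (Var x)).
Proof.
elim: phi => [x|s t IH] /=; first by rewrite bigcup_set1.
rewrite (hs s t) /=; apply/seteqP; split=> [z [k _ /=]|z [x [k _ xk] zx]].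
  by rewrite IH => -[x xk zx]; exists x => //; exists k.
by exists k => //=; rewrite IH; exists x.
Qed.

Section LeftCompanion.
Variables (S : signature) (L : logic S).

Lemma lcomp_refl (Gamma : set (form S)) phi : Gamma phi -> lcomp_entails L Gamma phi.
Proof.
move=> Gphi; exists [set phi]; split; first by move=> _ ->.
  by rewrite bigcup_set1.
exact: entails_refl.
Qed.

Lemma lcomp_cut (Gamma Delta : set (form S)) phi :
  (forall delta, Delta delta -> lcomp_entails L Gamma delta) ->
  lcomp_entails L Delta phi -> lcomp_entails L Gamma phi.
Proof.
move=> GD [D [DD Dv Dphi]].
exists [set gamma | Gamma gamma /\ vars gamma `<=` vars phi]; split.
- by move=> ? [].
- by move=> z [gamma [_ gv] /gv].
apply: entails_cut Dphi => delta Ddelta.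
have [G [GG Gv Gdelta]] := GD _ (DD _ Ddelta).
apply: entails_cut Gdelta => gamma Ggamma; apply: entails_refl.
split=> [|z zg]; first exact: GG.
by apply: Dv; exists delta => //; apply: Gv; exists gamma.
Qed.

Lemma lcomp_subst (sigma : Fm S -> Fm S) : hom sigma -> forall Gamma phi,
  lcomp_entails L Gamma phi -> lcomp_entails L (sigma @` Gamma) (sigma phi).
Proof.
move=> hs Gamma phi [G [GG Gv Gphi]]; exists (sigma @` G); split.
- exact: image_subset.
- move=> z [_ [gamma Ggamma <-]]; rewrite !vars_subst // => -[x xg zx].
  by exists x => //; apply: Gv; exists gamma.
- exact: entails_subst.
Qed.

Definition lcomp : logic S := Logic lcomp_refl lcomp_cut lcomp_subst.

End LeftCompanion.

Record matrix (S : signature) := Matrix {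
  alg_of :> algebra S;
  filter_of : set alg_of }.

Arguments filter_of {S} m _.

Definition trivial_matrix (S : signature) (M : matrix S) : Prop :=
  filter_of M = [set: M].

Definition model (S : signature) (L : logic S) (M : matrix S) : Prop :=
  forall Gamma phi, L Gamma phi ->
    forall h : Fm S -> M, hom h -> h @` Gamma `<=` filter_of M -> filter_of M (h phi).

Record congruence (S : signature) (A : algebra S) (theta : A -> A -> Prop) : Prop := {
  cong_refl : forall a, theta a a;
  cong_sym : forall a b, theta a b -> theta b a;
  cong_trans : forall a b c, theta a b -> theta b c -> theta a c;
  cong_op : forall (s : S) (a b : 'I_(arity s) -> A),
    (forall k, theta (a k) (b k)) -> theta (op A s a) (op A s b) }.

Definition compatible (A : Type) (theta : A -> A -> Prop) (F : set A) : Prop :=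
  forall a b, theta a b -> F a -> F b.

(* The union of all the compatible congruences;
   [leibniz_largest] shows that it is the largest one. *)
Definition leibniz (S : signature) (A : algebra S) (F : set A) (a b : A) : Prop :=
  exists theta : A -> A -> Prop, [/\ congruence theta, compatible theta F & theta a b].

Theorem leibniz_largest (S : signature) (A : algebra S) (F : set A) :
  [/\ congruence (leibniz F), compatible (leibniz F) F &
      forall theta : A -> A -> Prop, congruence theta -> compatible theta F ->
        forall a b, theta a b -> leibniz F a b].
Proof.
set R := fun a b : A => forall P : A -> Prop,
  P a -> (forall x y, leibniz F x y -> P x -> P y) -> P b.
have leR a b : leibniz F a b -> R a b by move=> ab P Pa HP; exact: HP ab Pa.
have Rr a : R a a by move=> P.
have Rt a b c : R a b -> R b c -> R a c.
  by move=> ab bc P Pa HP; exact: (bc P (ab P Pa HP) HP).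
have lesym a b : leibniz F a b -> leibniz F b a.
  by move=> [th [cth Fth ab]]; exists th; split=> //; exact: cong_sym.
have Rs a b : R a b -> R b a.
  move=> ab; apply: (ab (R^~ a)) => // x y xy xa; exact: Rt (leR _ _ (lesym _ _ xy)) xa.
have Rop1 (s : S) (c : 'I_(arity s) -> A) k x y : R x y ->
    R (op A s (fun l => if l == k then x else c l))
      (op A s (fun l => if l == k then y else c l)).
  move=> xy; apply: (xy (fun z => R _ (op A s (fun l => if l == k then z else c l)))) => //.
  move=> u v [th [cth Fth uv]] H; apply: Rt H _; apply: leR.
  exists th; split=> //; apply: cong_op => // l.
  by case: ifP => // _; exact: cong_refl.
have Rop (s : S) (a b : 'I_(arity s) -> A) :
    (forall k, R (a k) (b k)) -> R (op A s a) (op A s b).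
  move=> ab.
  have H n : n <= arity s ->
      R (op A s a) (op A s (fun l => if l < n then b l else a l)).
    elim: n => [_|n IH ns].
      by rewrite (_ : (fun _ => _) = a) //; exact: funext.
    apply: Rt (IH (ltnW ns)) _.
    have := Rop1 s (fun l => if l < n then b l else a l) (Ordinal ns) _ _ (ab (Ordinal ns)).
    congr (R (op A s _) (op A s _)); apply: funext => l.
      by case: eqP => // ->; rewrite ltnn.
    rewrite ltnS (leq_eqVlt l n); case: (eqVneq l (Ordinal ns)) => [->|] /=.
      by rewrite eqxx.
    by rewrite -val_eqE /= => /negbTE ->.
  have := H _ (leqnn _); congr (R _ (op A s _)).
  by apply: funext => l; rewrite ltn_ord.
have RF : compatible R F.
  by move=> a b ab Fa; apply: (ab F) => // x y [th [_ Fth xy]]; exact: Fth xy.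
have RleP a b : R a b -> leibniz F a b by exists R; split.
split.
- split; first by move=> a; exact: RleP.
  + exact: lesym.
  + by move=> a b c /leR ab /leR bc; apply: RleP; exact: Rt bc.
  + by move=> s a b ab; apply: RleP; apply: Rop => k; exact: leR.
- by move=> a b /leR; exact: RF.
- by move=> th cth Fth a b ab; exists th.
Qed.

Definition suszko (S : signature) (L : logic S) (A : algebra S) (F : set A)
    (a b : A) : Prop :=
  forall G : set A, model L (Matrix G) -> F `<=` G -> leibniz G a b.

Definition Mod_star (S : signature) (L : logic S) (M : matrix S) : Prop :=
  model L M /\ forall a b : M, leibniz (filter_of M) a b <-> a = b.

Definition Mod_Su (S : signature) (L : logic S) (M : matrix S) : Prop :=
  model L M /\ forall a b : M, suszko L (filter_of M) a b <-> a = b.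

Definition Alg (S : signature) (L : logic S) (A : algebra S) : Prop :=
  exists F : set A, Mod_Su L (Matrix F).

Definition equivalential (S : signature) (L : logic S) : Prop :=
  exists Delta : set (form S),
    (forall delta, Delta delta -> vars delta `<=` [set 0; 1]) /\
    forall M : matrix S, model L M -> forall a b : M,
      leibniz (filter_of M) a b <-> eval (val2 a b) @` Delta `<=` filter_of M.

Definition inconsistency_terms (S : signature) (L : logic S) (Sigma : set (form S)) : Prop :=
  forall sigma : Fm S -> Fm S, hom sigma -> forall phi, L (sigma @` Sigma) phi.

Record partition_function (S : signature) (A : algebra S) (dot : A -> A -> A) : Prop := {
  pf_idem : forall a, dot a a = a;
  pf_assoc : forall a b c, dot a (dot b c) = dot (dot a b) c;
  pf_comm : forall a b c, dot a (dot b c) = dot a (dot c b);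
  pf_opl : forall (s : S) (a : 'I_(arity s) -> A) b,
    dot (op A s a) b = op A s (fun k => dot (a k) b);
  pf_opr : forall (s : S) (a : 'I_(arity s) -> A) b,
    dot b (op A s a) = foldl dot b [seq a k | k : 'I_(arity s)] }.

Definition has_partition_function (S : signature) (L : logic S) : Prop :=
  exists pi : form S, [/\ vars pi = [set 0; 1], L [set Var 0] pi &
    forall A : algebra S, Alg L A ->
      partition_function (fun a b : A => eval (val2 a b) pi)].

Record semilattice := Semilattice {
  index :> Type;
  index_inhabited : inhabited index;
  join : index -> index -> index;
  joinA : associative join;
  joinC : commutative join;
  joinxx : idempotent_op join }.

Definition sle (I : semilattice) (i j : I) : Prop := join i j = j.

Definition joins (I : semilattice) (n : nat) (i : 'I_n.+1 -> I) : I :=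
  foldl (@join I) (i ord0) [seq i (lift ord0 k) | k : 'I_n].

Lemma sle_joins (I : semilattice) (n : nat) (i : 'I_n.+1 -> I) (k : 'I_n.+1) :
  sle (i k) (joins i).
Proof.
have sle_trans (x y z : I) : sle x y -> sle y z -> sle x z.
  by rewrite /sle => xy <-; rewrite joinA xy.
have slel (x y : I) : sle x (join x y) by rewrite /sle joinA joinxx.
have sler (x y : I) : sle x (join y x) by rewrite joinC.
have acc (T : Type) (f : T -> I) (x : I) (s : seq T) :
    sle x (foldl (@join I) x [seq f t | t <- s]).
  elim: s x => [|t s IH] x /=; first exact: joinxx.
  exact: sle_trans (slel _ _) (IH _).
have mem (T : eqType) (f : T -> I) (x : I) (s : seq T) t : t \in s ->
    sle (f t) (foldl (@join I) x [seq f t | t <- s]).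
  elim: s x => [//|u s IH] x /=; rewrite inE => /orP[/eqP ->|/IH//].
  exact: sle_trans (sler _ _) (acc _ _ _ _).
rewrite /joins; case: (unliftP ord0 k) => [l ->|->]; last exact: acc.
exact: (mem _ (fun l => i (lift ord0 l)) _ _ l (mem_enum _ _)).
Qed.

(* Fibres are types, so disjointness of the universes is obtained in
   [plonka_alg] by tagging. Quantifying over all proofs of [sle] in [tr_id] and
   [tr_comp] makes [tr] independent of the proof. *)
Record directed_system (S : signature) := DirectedSystem {
  ds_index :> semilattice;
  fibre : ds_index -> matrix S;
  tr : forall i j : ds_index, sle i j -> fibre i -> fibre j;
  tr_hom : forall i j (ij : sle i j), hom (tr ij);
  tr_filter : forall i j (ij : sle i j),
    tr ij @` filter_of (fibre i) `<=` filter_of (fibre j);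
  tr_id : forall i (ii : sle i i) a, tr ii a = a;
  tr_comp : forall i j k (ij : sle i j) (jk : sle j k) (ik : sle i k) a,
    tr ik a = tr jk (tr ij a) }.

Arguments fibre {S} d i.

Section Plonka.
Variables (S : signature) (X : directed_system S).

Let B : Type := {i : X & fibre X i}.

Lemma plonka_inhabited : inhabited B.
Proof.
have [i] := index_inhabited X; have [a] := carrier_inhabited (fibre X i).
exact: (inhabits (existT _ i a)).
Qed.

Definition plonka_op (s : S) (a : 'I_(arity s) -> B) : B :=
  let i := fun k => projT1 (a k) in
  existT _ (joins i)
    (op (fibre X (joins i)) s (fun k => tr (sle_joins i k) (projT2 (a k)))).

Definition plonka_alg : algebra S := Algebra plonka_inhabited plonka_op.

Definition plonka : matrix S :=
  @Matrix S plonka_alg [set x : B | filter_of (fibre X (projT1 x)) (projT2 x)].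

End Plonka.

Definition matrix_iso (S : signature) (M N : matrix S) : Prop :=
  exists h : M -> N, [/\ hom h, bijective h &
    forall a, filter_of M a <-> filter_of N (h a)].

(* Main.v *)
(* Write [a.b] for the partition function and [Delta] for the equivalence formulas.

   In a reduced model of the equivalential logic, [Delta(d, d.b)] takes the same
   values as [Delta(d.b, d.b)], so [d.b = d]; and inconsistency terms make
   triviality of a fibre propagate upwards.

   Given a Plonka sum as in (ii), if [a] in the fibre [i] and [b] in the fibre [j]
   are Suszko congruent and [j] is not below [i], add to the filter all fibres
   above [j]: every [c = c.a] of the fibre [i] is congruent to [c.b], which lies in
   the enlarged filter, so the fibre [i] is trivial. Uniqueness of the trivial
   fibre then forces [i = j], and the fibre being reduced gives [a = b].

   Conversely, regular identities pass from Alg of the logic to Alg of its left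
   variable inclusion companion, so a Suszko reduced model decomposes into fibres
   along the partition function. By finitarity the fibres are models. Two elements
   of one fibre with [Delta(a, b)] in the filter are Leibniz congruent for every
   larger filter, hence equal; and identifying all elements of trivial fibres is a
   congruence compatible with every larger filter. *)

Require Import Defs.
From mathcomp Require Import all_boot.
From mathcomp Require Import mathcomp_extra boolp classical_sets functions cardinality.

Set Implicit Arguments.
Unset Strict Implicit.
Unset Printing Implicit Defensive.

Local Open Scope classical_set_scope.

(** * Quotients by an equivalence relation, with chosen representatives *)

Section Quotient.
Variables (T : Type) (R : T -> T -> Prop).

Definition quot : Type := {c : set T | exists a, c = R a}.

Definition cls (a : T) : quot := exist _ (R a) (ex_intro _ a erefl).

Definition repr (q : quot) : T := sval (cid (svalP q)).

Lemma reprK q : cls (repr q) = q.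
Proof. by rewrite /repr; case: cid => a /= e; case: q e => c cR /= e; exact/eq_exist. Qed.

Hypothesis R_refl : forall a, R a a.
Hypothesis R_sym : forall a b, R a b -> R b a.
Hypothesis R_trans : forall a b c, R a b -> R b c -> R a c.

Lemma cls_eq a b : cls a = cls b <-> R a b.
Proof.
split=> [/(congr1 sval) /= e|ab]; first by rewrite e; exact: R_refl.
apply: eq_exist; apply: funext => c; apply: propext; split; last exact: R_trans.
exact/R_trans/R_sym.
Qed.

End Quotient.

(** * Evaluation of formulas, and Leibniz and Suszko congruences under homomorphisms *)

Section Evaluation.
Variable S : signature.

Lemma eval_comp (A B : algebra S) (h : A -> B) (hh : hom h) (v : nat -> A) phi :
  h (eval v phi) = eval (h \o v) phi.
Proof.
by elim: phi => //= s t IH; rewrite hh; congr (op B s _); apply: funext => k /=.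
Qed.

Lemma eval_subst (A : algebra S) (v : nat -> A) (sigma : nat -> Fm S) phi :
  eval v (eval sigma phi) = eval (eval v \o sigma) phi.
Proof. exact: (@eval_comp (Fm S) A (eval v) (eval_hom v)). Qed.

Lemma eval_ext (A : algebra S) (v w : nat -> A) phi :
  (forall x, vars phi x -> v x = w x) -> eval v phi = eval w phi.
Proof.
elim: phi => [x|s t IH] /= vw; first exact: vw.
by congr (op A s _); apply: funext => k; apply: IH => x xk; apply: vw; exists k.
Qed.

Lemma val2_comp (A B : Type) (h : A -> B) a b : h \o val2 a b = val2 (h a) (h b).
Proof. by apply: funext; case. Qed.

Lemma eval_val2_comp (A B : algebra S) (h : A -> B) (hh : hom h) a b phi :
  h (eval (val2 a b) phi) = eval (val2 (h a) (h b)) phi.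
Proof. by rewrite eval_comp// val2_comp. Qed.

Lemma leibniz_refl (A : algebra S) (F : set A) a : leibniz F a a.
Proof. by have [[r _ _ _] _ _] := leibniz_largest F. Qed.

Lemma leibniz_sym (A : algebra S) (F : set A) a b : leibniz F a b -> leibniz F b a.
Proof. by have [[_ r _ _] _ _] := leibniz_largest F; exact: r. Qed.

Lemma leibniz_trans (A : algebra S) (F : set A) a b c :
  leibniz F a b -> leibniz F b c -> leibniz F a c.
Proof. by have [[_ _ r _] _ _] := leibniz_largest F; exact: r. Qed.

Lemma leibniz_op (A : algebra S) (F : set A) (s : S) (a b : 'I_(arity s) -> A) :
  (forall k, leibniz F (a k) (b k)) -> leibniz F (op A s a) (op A s b).
Proof. by have [[_ _ _ r] _ _] := leibniz_largest F; exact: r. Qed.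

Lemma leibniz_compatible (A : algebra S) (F : set A) a b : leibniz F a b -> F a -> F b.
Proof. by have [_ r _] := leibniz_largest F; exact: r. Qed.

Lemma leibniz_max (A : algebra S) (F : set A) theta a b :
  congruence theta -> compatible theta F -> theta a b -> leibniz F a b.
Proof. by move=> ? ? ?; exists theta. Qed.

Lemma leibniz_eval (A : algebra S) (F : set A) (v w : nat -> A) phi :
  (forall n, leibniz F (v n) (w n)) -> leibniz F (eval v phi) (eval w phi).
Proof. by move=> vw; elim: phi => //= s t IH; exact: leibniz_op. Qed.

(** The Leibniz congruence of [G], pulled back along [h], is a congruence compatible with the
    preimage of [G]. *)
Lemma leibniz_preimage (A B : algebra S) (h : A -> B) (G : set B) a b :
  hom h -> leibniz G (h a) (h b) -> leibniz (h @^-1` G) a b.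
Proof.
move=> hh; apply: (@leibniz_max _ _ (fun a b => leibniz G (h a) (h b))).
  split=> [c|c d|c d e|s c d cd].
  - exact: leibniz_refl.
  - exact: leibniz_sym.
  - exact: leibniz_trans.
  - by rewrite !hh; exact: leibniz_op.
by move=> c d; exact: leibniz_compatible.
Qed.

Lemma model_preimage (L : logic S) (A B : algebra S) (h : A -> B) (G : set B) :
  hom h -> model L (@Matrix S B G) -> model L (@Matrix S A (h @^-1` G)).
Proof.
move=> hh LG Gamma phi GLphi f hf fG.
apply: (LG _ _ GLphi (h \o f)) => [s a|_ [g Gg <-]]; first by rewrite /= hf hh.
by apply: (fG (f g)); exists g.
Qed.

Lemma matrix_iso_Mod_Su (L : logic S) (M N : matrix S) :
  matrix_iso M N -> Mod_Su L N -> Mod_Su L M.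
Proof.
case: M N => [A F] [B G] [h /= [hh [g hK gK] hF]] [LN red].
have hg : hom g.
  by move=> s a; apply: (can_inj hK); rewrite gK hh; congr (op B s _); apply: funext => k /=.
have FE : F = h @^-1` G by apply/seteqP; split=> a /hF.
split; first by rewrite FE; exact: model_preimage.
move=> a b; split=> [ab|-> H _ _]; last exact: leibniz_refl.
apply: (can_inj hK); apply/red => H LH GH.
(* Writing [H] as a preimage under the inverse [g] lets [leibniz_preimage] carry the congruence from
   [A] to [B]. *)
have -> : H = g @^-1` (h @^-1` H) by apply/seteqP; split=> c /=; rewrite gK.
apply: leibniz_preimage => //; rewrite !hK; apply: ab; first exact: model_preimage.
by rewrite FE => c; exact: GH.
Qed.

End Evaluation.

(* A reflexive relation has increasing powers, so finitely many pairs of its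
   transitive closure lie in a common power. *)
Lemma leibniz_tolerance (S : signature) (A : algebra S) (F : set A)
    (R : A -> A -> Prop) :
  (forall a, R a a) -> (forall a b, R a b -> R b a) ->
  (forall (s : S) (a b : 'I_(arity s) -> A),
    (forall k, R (a k) (b k)) -> R (op A s a) (op A s b)) ->
  compatible R F -> forall a b, R a b -> leibniz F a b.
Proof.
move=> Rr Rs Ro RF a b Rab.
pose P := fix P n x y := if n is n'.+1 then exists2 z, R x z & P n' z y else x = y.
have Pcat m n x y z : P m x y -> P n y z -> P (m + n) x z.
  elim: m x => [x -> //|m IH x [u xu uy] yz].
  by rewrite addSn; exists u => //; exact: IH yz.
have P1 x y : R x y -> P 1 x y by exists y.
have Psym n x y : P n x y -> P n y x.
  elim: n x => [x -> //|n IH x [u xu /IH yu]].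
  by rewrite -addn1; apply: Pcat yu _; apply: P1; exact: Rs.
have Prefl n x : P n x x by elim: n => //= n IH; exists x.
have Ple m n x y : m <= n -> P m x y -> P n x y.
  by move=> /subnK <- xy; rewrite addnC; exact: Pcat xy (Prefl _ _).
have Pop n (s : S) (x y : 'I_(arity s) -> A) :
    (forall k, P n (x k) (y k)) -> P n (op A s x) (op A s y).
  elim: n x => [x xy|n IH x xy]; first by rewrite (funext xy).
  have [z zP] := choice (fun k => let: ex_intro2 z u v := xy k in
    ex_intro (fun z => R (x k) z /\ P n z (y k)) z (conj u v)).
  by exists (op A s z); [apply: Ro => k; have [] := zP k|apply: IH => k; have [] := zP k].
apply: (@leibniz_max _ _ _ (fun x y => exists n, P n x y)); last by exists 1; exact: P1.
- split=> [x|x y [n xy]|x y z [m xy] [n yz]|s x y xy].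
  + by exists 0.
  + by exists n; exact: Psym.
  + by exists (m + n); exact: Pcat xy yz.
  + have [n nP] := choice xy.
    exists (\max_k n k); apply: Pop => k; apply: Ple (nP k); exact: leq_bigmax.
- move=> x y [n]; elim: n x => [x -> //|n IH x [z xz zy] Fx].
  exact: IH zy (RF _ _ xz Fx).
Qed.

(** * Leibniz quotients and the identities valid in the algebras of a logic *)

Section Completeness.
Variables (S : signature) (L : logic S).

Section LeibnizQuotient.
Variable M : matrix S.

Let R : M -> M -> Prop := leibniz (filter_of M).

Let clsE a b : cls R a = cls R b <-> leibniz (filter_of M) a b.
Proof.
apply: cls_eq => [?|? ?|? ? ?]; [exact: leibniz_refl|exact: leibniz_sym|exact: leibniz_trans].
Qed.

Lemma leibniz_quotient_inhabited : inhabited (quot R).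
Proof. by have [a] := carrier_inhabited M; exact: (inhabits (cls R a)). Qed.

Definition leibniz_quotient_alg : algebra S :=
  Algebra leibniz_quotient_inhabited
    (fun s a => cls R (op M s (fun k => repr (a k)))).

Definition leibniz_quotient : matrix S :=
  @Matrix S leibniz_quotient_alg [set q | filter_of M (repr q)].

Definition leibniz_proj (a : M) : leibniz_quotient := cls R a.

Lemma leibniz_projE a b : leibniz_proj a = leibniz_proj b <-> leibniz (filter_of M) a b.
Proof. exact: clsE. Qed.

Lemma leibniz_proj_hom : hom leibniz_proj.
Proof.
move=> s a; apply/clsE; apply: leibniz_op => k; apply: leibniz_sym.
by apply/clsE; rewrite reprK.
Qed.

Lemma leibniz_proj_filter a : filter_of leibniz_quotient (leibniz_proj a) <-> filter_of M a.
Proof.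
have ra : leibniz (filter_of M) (repr (cls R a)) a by apply/clsE; rewrite reprK.
split; [exact: leibniz_compatible ra|exact: leibniz_compatible (leibniz_sym ra)].
Qed.

(** Valuations in the quotient lift to [M] along representatives. A compatible congruence of the
    quotient pulls back to one of [M], hence lies in the Leibniz congruence that was factored
    out. *)
Lemma leibniz_quotient_Mod_star : model L M -> Mod_star L leibniz_quotient.
Proof.
move=> LM; split=> [Gamma phi GLphi h hh hG|p q].
  pose v n := repr (h (Var n)).
  have hE psi : h psi = leibniz_proj (eval v psi).
    rewrite (hom_eval hh) (eval_comp leibniz_proj_hom); apply: eval_ext => x _ /=.
    by rewrite /leibniz_proj reprK.
  rewrite hE; apply/leibniz_proj_filter; apply: (LM _ _ GLphi _ (eval_hom v)).
  by move=> _ [g Gg <-]; apply/leibniz_proj_filter; rewrite -hE; apply: hG; exists g.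
split=> [[th [thc thF pq]]|->]; last exact: leibniz_refl.
rewrite -(reprK p) -(reprK q); apply/clsE.
exists (fun a b => th (leibniz_proj a) (leibniz_proj b)); split.
- split=> [a|a b|a b c|s a b ab]; [exact: cong_refl|exact: cong_sym|exact: cong_trans|].
  by rewrite !leibniz_proj_hom; exact: cong_op.
- by move=> a b ab Fa; apply/leibniz_proj_filter; apply: thF ab _; apply/leibniz_proj_filter.
- by rewrite /leibniz_proj !reprK.
Qed.

End LeibnizQuotient.

(** The filter itself is among those intersected by the Suszko congruence, which therefore lies
    inside the Leibniz congruence. *)
Lemma Mod_star_Alg (M : matrix S) : Mod_star L M -> Alg L M.
Proof.
move=> [LM red]; exists (filter_of M); split; first by case: M LM {red}.
move=> a b; split=> [ab|-> G _ _]; last exact: leibniz_refl.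
by apply/red; apply: ab => //; case: M LM {a b red ab}.
Qed.

Definition valid_identity (t u : form S) : Prop :=
  forall B : algebra S, Alg L B -> forall v : nat -> B, eval v t = eval v u.

Lemma valid_identity_sym t u : valid_identity t u -> valid_identity u t.
Proof. by move=> tu B LB v; rewrite tu. Qed.

(** The theory generated by [t] is a filter of the formula algebra whose Leibniz quotient lies in
    [Alg L]. There [t] and [u] coincide, so compatibility puts [u] into the theory. *)
Lemma valid_identity_entails t u : valid_identity t u -> L [set t] u.
Proof.
move=> tu; pose M := @Matrix S (Fm S) [set psi | L [set t] psi].
have LM : model L M.
  move=> Gamma phi GLphi h hh hG; apply: entails_cut (entails_subst hh GLphi).
  by move=> psi /hG.
have LB := Mod_star_Alg (leibniz_quotient_Mod_star LM).
have := tu _ LB (@leibniz_proj M \o Var).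
rewrite -!(eval_comp (@leibniz_proj_hom M)).
have id_eval psi : eval (Var : nat -> Fm S) psi = psi.
  by elim: psi => //= s k IH; congr App; exact: funext.
move=> /leibniz_projE; rewrite !id_eval => /leibniz_compatible; apply.
exact: entails_refl.
Qed.

(* The variables of distinct arguments are renamed apart through [n * x + k],
   where [n] is the arity. *)
Lemma regular_identity (A : algebra S) (t u : form S) :
  Alg (lcomp L) A -> vars t = vars u -> valid_identity t u ->
  forall v : nat -> A, eval v t = eval v u.
Proof.
move=> [F [_ red]] tu_vars tu v; apply/red => G LG _.
(* Nothing forces two consecutive pairs of [R] to use the same assignment, so transitivity is
   unclear and [leibniz_tolerance] is applied instead. *)
pose R (a b : A) := exists w t' u', [/\ vars t' = vars u', valid_identity t' u',
  a = eval w t' & b = eval w u'].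
apply: (@leibniz_tolerance _ _ _ R); last by exists v, t, u.
- by move=> a; exists (fun _ => a), (Var 0), (Var 0).
- move=> a b [w [t' [u' [e val -> ->]]]]; exists w, u', t'; split=> //.
  exact: valid_identity_sym.
- move=> s a b ab.
  have [w /choice[t' /choice[u' wP]]] := choice ab.
  pose ren (k : 'I_(arity s)) x : Fm S := Var (x * arity s + k).
  exists (fun x => w (inord (x %% arity s)) (x %/ arity s)),
    (App s (fun k => eval (ren k) (t' k))), (App s (fun k => eval (ren k) (u' k))).
  have renK k psi : eval (fun x => w (inord (x %% arity s)) (x %/ arity s))
      (eval (ren k) psi) = eval (w k) psi.
    rewrite eval_subst; apply: eval_ext => x _ /=.
    by rewrite modnMDl divnMDl// modn_small// divn_small// addn0 inord_val.
  split=> /=.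
  + apply: eq_bigcupr => k _; have [e _ _ _] := wP k.
    by rewrite !(vars_subst (eval_hom (ren k))) e.
  + move=> B LB w' /=; congr (op B s _); apply: funext => k.
    by have [_ val _ _] := wP k; rewrite !eval_subst; exact: val.
  + by congr (op A s _); apply: funext => k; have [_ _ -> _] := wP k; rewrite renK.
  + by congr (op A s _); apply: funext => k; have [_ _ _ ->] := wP k; rewrite renK.
- move=> _ _ [w [t' [u' [e val -> ->]]]] Gt.
  (* Equality of the variable sets turns the entailment of [L] from [t'] to [u'] into one of the
     left companion. *)
  apply: (LG [set t'] u' _ _ (eval_hom w)); last by move=> _ [_ -> <-].
  exists [set t']; split=> //; last exact: valid_identity_entails.
  by rewrite bigcup_set1 e.
Qed.

End Completeness.

(** * Order and finite joins in a semilattice *)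

Section Semilattice.
Variable I : semilattice.

Lemma sle_refl (i : I) : sle i i.
Proof. exact: joinxx. Qed.

Lemma sle_trans (i j k : I) : sle i j -> sle j k -> sle i k.
Proof. by rewrite /sle => ij <-; rewrite joinA ij. Qed.

Lemma sle_anti (i j : I) : sle i j -> sle j i -> i = j.
Proof. by rewrite /sle joinC => ->. Qed.

Lemma joins_le n (i : 'I_n.+1 -> I) j : (forall k, sle (i k) j) -> sle (joins i) j.
Proof.
move=> ij; rewrite /joins /image_mem.
elim: (enum _) (i ord0) (ij ord0) => //= k r IH l lj; apply: IH.
by rewrite /sle -joinA (ij _).
Qed.

Lemma joins_const n (i : I) : joins (fun _ : 'I_n.+1 => i) = i.
Proof.
apply: sle_anti; first by apply: joins_le => _; exact: sle_refl.
exact: (sle_joins (fun _ => i) ord0).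
Qed.

End Semilattice.

(** * Evaluation and models in Plonka sums *)

Section PlonkaSum.
Variables (S : signature) (L : logic S) (X : directed_system S).

Definition plonka_in (i : X) (a : fibre X i) : plonka X := existT (fun i => fibre X i) i a.

Lemma tr_mem (i j : X) (ij : sle i j) a :
  filter_of (fibre X i) a -> filter_of (fibre X j) (tr ij a).
Proof. by move=> Fa; have := @tr_filter _ _ _ _ ij (tr ij a); apply; exists a. Qed.

(** Equal indices may still give syntactically different fibre types; the transition map serves as
    the cast between them. *)
Lemma plonka_inE (i j : X) (ij : sle i j) a : i = j -> plonka_in a = plonka_in (tr ij a).
Proof. by move=> e; case: _ / e in ij *; rewrite tr_id. Qed.

Lemma plonka_in_hom (i : X) : hom (@plonka_in i).
Proof.
move=> s a.
have e : i = joins (fun _ : 'I_(arity s) => i) by rewrite joins_const.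
have ij : sle i (joins (fun _ : 'I_(arity s) => i)) by rewrite -e; exact: sle_refl.
rewrite (plonka_inE ij) // tr_hom; congr (@plonka_in _ (op _ s _)).
by apply: funext => k /=; congr tr; exact: Prop_irrelevance.
Qed.

(** With [plonka_eval_le] this says that the index of a value is the join of the indices of its
    variables. *)
Lemma plonka_eval_ge (v : nat -> plonka X) phi x : vars phi x ->
  sle (projT1 (v x)) (projT1 (eval v phi)).
Proof.
elim: phi => [y -> |s t IH [k _ /IH xk]] /=; first exact: sle_refl.
exact: sle_trans xk (sle_joins (fun k => projT1 (eval v (t k))) k).
Qed.

Lemma plonka_eval_le (v : nat -> plonka X) phi (j : X) :
  (forall x, vars phi x -> sle (projT1 (v x)) j) -> sle (projT1 (eval v phi)) j.
Proof.
elim: phi => [y|s t IH] /= vj; first exact: vj.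
by apply: joins_le => k; apply: IH => x xk; apply: vj; exists k.
Qed.

Lemma plonka_eval_tr (v : nat -> plonka X) phi (j : X) (w : nat -> fibre X j) :
  (forall x (xj : sle (projT1 (v x)) j), vars phi x -> w x = tr xj (projT2 (v x))) ->
  forall h : sle (projT1 (eval v phi)) j, tr h (projT2 (eval v phi)) = eval w phi.
Proof.
elim: phi => [y|s t IH] /= vw h; first by rewrite -vw.
rewrite tr_hom; congr (op _ s _); apply: funext => k /=.
have kj := sle_trans (sle_joins (fun k => projT1 (eval v (t k))) k) h.
by rewrite -(tr_comp _ _ kj) IH // => x xj xk; apply: vw; exists k.
Qed.

(** Premises with variables in the conclusion take values in fibres below that of the conclusion.
    Moved up into that fibre, they form an instance of an entailment of [L]. The family [G] is
    general because enlarged filters are needed besides the original ones. *)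
Lemma plonka_model (G : forall i : X, set (fibre X i)) :
  (forall (i j : X) (ij : sle i j) a, G i a -> G j (tr ij a)) ->
  (forall i, model L (@Matrix S (fibre X i) (G i))) ->
  model (lcomp L) (@Matrix S (plonka_alg X) [set u | G (projT1 u) (projT2 u)]).
Proof.
move=> G_tr LG Gamma phi [Gamma' [GG Gv Gphi]] h hh hG.
rewrite (hom_eval hh); set v : nat -> plonka X := h \o Var.
set j := projT1 (eval v phi).
(* A variable whose fibre is not below [j] does not occur in [phi]; it gets an arbitrary element of
   the fibre [j]. *)
pose w x := if pselect (sle (projT1 (v x)) j) is left xj then tr xj (projT2 (v x))
  else projT2 (eval v phi).
have wE x (xj : sle (projT1 (v x)) j) : w x = tr xj (projT2 (v x)).
  by rewrite /w; case: pselect => // xj'; congr tr; exact: Prop_irrelevance.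
rewrite /= -[projT2 _](tr_id (sle_refl _)) (@plonka_eval_tr _ _ _ w)//.
apply: (LG j Gamma' phi Gphi _ (eval_hom w)) => _ [g Gg <-].
have gj : sle (projT1 (eval v g)) j.
  by apply: plonka_eval_le => x xg; apply: plonka_eval_ge; apply: Gv; exists g.
rewrite /= -(@plonka_eval_tr v g j w _ gj)//; apply: G_tr.
by have := hG (h g); rewrite (hom_eval hh); apply; exists g => //; exact: GG.
Qed.

End PlonkaSum.

(** * The decomposition of an algebra along a partition function *)

Section PartitionFunction.
Variables (S : signature) (A : algebra S) (dot : A -> A -> A).
Hypothesis P : partition_function dot.

Lemma pf_hom b : hom (fun a => dot a b).
Proof. by move=> s a; exact: pf_opl. Qed.

Lemma pf_swap a b c : dot (dot a b) c = dot (dot a c) b.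
Proof. by rewrite -!(pf_assoc P) (pf_comm P). Qed.

Lemma pf_foldl a b r : dot (foldl dot a r) b = foldl dot (dot a b) r.
Proof. by elim: r a => //= c r IH a; rewrite IH pf_swap. Qed.

(** Squaring the value and expanding the right factor by [pf_opr] makes [a k] one of the right
    factors; these commute and are idempotent. *)
Lemma pf_op_arg (s : S) (a : 'I_(arity s) -> A) k : dot (op A s a) (a k) = op A s a.
Proof.
rewrite -{1 2}(pf_idem P (op A s a)) (pf_opr P) pf_foldl /image_mem.
have : k \in enum 'I_(arity s) by rewrite mem_enum.
elim: (enum _) (op A s a) => //= l r IH b; rewrite inE => /orP[/eqP <-|/IH H].
  by rewrite -(pf_assoc P) (pf_idem P).
by rewrite pf_swap H.
Qed.

Lemma pf_absorb (v : nat -> A) phi x :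
  vars phi x -> dot (eval v phi) (v x) = eval v phi.
Proof.
elim: phi => [y -> |s t IH [k _ kx]] /=; first exact: pf_idem.
have tk := pf_op_arg (fun k => eval v (t k)) k.
by rewrite -{1}tk -(pf_assoc P) IH.
Qed.

(** Green's relation L of the left normal band; its classes become the fibres. *)
Definition same (a b : A) : Prop := dot a b = a /\ dot b a = b.

Lemma same_refl a : same a a.
Proof. by split; exact: pf_idem. Qed.

Lemma same_sym a b : same a b -> same b a.
Proof. by case. Qed.

Lemma same_trans a b c : same a b -> same b c -> same a c.
Proof.
move=> [ab ba] [bc cb]; split; first by rewrite -{1}ab -(pf_assoc P) bc ab.
by rewrite -{1}cb -(pf_assoc P) ba cb.
Qed.

Lemma same_dot a a' b b' : same a a' -> same b b' -> same (dot a b) (dot a' b').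
Proof.
suff H c c' d d' : same c c' -> same d d' -> dot (dot c d) (dot c' d') = dot c d.
  by move=> aa bb; split; apply: H => //; exact: same_sym.
by move=> [cc _] [dd _]; rewrite (pf_assoc P) (pf_swap c d c') cc -(pf_assoc P) dd.
Qed.

Lemma same_dotC a b : same (dot a b) (dot b a).
Proof.
suff H c d : dot (dot c d) (dot d c) = dot c d by split; exact: H.
by rewrite (pf_assoc P) -(pf_assoc P c d d) (pf_idem P) pf_swap (pf_idem P).
Qed.

Definition pf_index : Type := quot same.

Definition pf_cls (a : A) : pf_index := cls same a.

Lemma pf_clsE a b : pf_cls a = pf_cls b <-> same a b.
Proof. exact: cls_eq same_refl same_sym same_trans a b. Qed.

Lemma pf_reprK (i : pf_index) : pf_cls (repr i) = i.
Proof. exact: reprK. Qed.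

Definition pf_join (i j : pf_index) : pf_index := pf_cls (dot (repr i) (repr j)).

Lemma pf_cls_dot a b : pf_cls (dot a b) = pf_join (pf_cls a) (pf_cls b).
Proof.
by apply/pf_clsE/same_dot; apply: same_sym; apply/pf_clsE; rewrite pf_reprK.
Qed.

Lemma pf_joinA : associative pf_join.
Proof.
move=> i j k; rewrite -(pf_reprK i) -(pf_reprK j) -(pf_reprK k) -!pf_cls_dot.
by rewrite (pf_assoc P).
Qed.

Lemma pf_joinC : commutative pf_join.
Proof.
move=> i j; rewrite -(pf_reprK i) -(pf_reprK j) -!pf_cls_dot; apply/pf_clsE.
exact: same_dotC.
Qed.

Lemma pf_joinxx : idempotent_op pf_join.
Proof. by move=> i; rewrite -(pf_reprK i) -pf_cls_dot (pf_idem P). Qed.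

Lemma pf_index_inhabited : inhabited pf_index.
Proof. by have [a] := carrier_inhabited A; exact: (inhabits (pf_cls a)). Qed.

Definition pf_semilattice : semilattice :=
  Semilattice pf_index_inhabited pf_joinA pf_joinC pf_joinxx.

Lemma pf_sleE a b : @sle pf_semilattice (pf_cls a) (pf_cls b) <-> dot b a = b.
Proof.
rewrite /sle /= -pf_cls_dot pf_clsE /same -(pf_assoc P a b b) (pf_assoc P b a b).
by rewrite (pf_swap b a b) !(pf_idem P); split=> [[]|].
Qed.

(** The class of [a ord0] lies below that of the value, so prefixing the value by [a ord0] keeps the
    class; [pf_opr] then expands it into the product of the arguments. *)
Lemma pf_cls_op (s : S) (a : 'I_(arity s) -> A) :
  pf_cls (op A s a) = @joins pf_semilattice _ (pf_cls \o a).
Proof.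
have /pf_sleE <- := pf_op_arg a ord0.
rewrite /= -pf_cls_dot (pf_opr P) /image_mem enum_ordSl /= (pf_idem P) -map_comp.
rewrite /joins /image_mem /=.
elim: (enum _) (a ord0) => //= k r IH b.
by rewrite IH pf_cls_dot.
Qed.

Lemma pf_op_top (s : S) (a : 'I_(arity s) -> A) :
  op A s (fun k => dot (a k) (repr (pf_cls (op A s a)))) = op A s a.
Proof.
rewrite -[LHS](pf_opl P); apply/pf_sleE; rewrite pf_reprK; exact: sle_refl.
Qed.

Section Fibre.
Variable i : pf_index.

Definition pf_fibre : Type := {a : A | pf_cls a = i}.

Lemma pf_fibre_inhabited : inhabited pf_fibre.
Proof. exact: (inhabits (exist _ (repr i) (pf_reprK i))). Qed.

Lemma pf_fibre_op_subproof (s : S) (a : 'I_(arity s) -> pf_fibre) :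
  pf_cls (op A s (fun k => sval (a k))) = i.
Proof.
rewrite pf_cls_op -[RHS](@joins_const pf_semilattice (arity_pred s)).
by congr (@joins pf_semilattice _ _); apply: funext => k /=; exact: (svalP (a k)).
Qed.

Definition pf_fibre_alg : algebra S :=
  Algebra pf_fibre_inhabited (fun s a => exist _ _ (pf_fibre_op_subproof a)).

Definition pf_val (a : pf_fibre_alg) : A := sval a.

Lemma pf_val_hom : hom pf_val.
Proof. by []. Qed.

Lemma pf_val_inj a b : pf_val a = pf_val b -> a = b.
Proof. by case: a b => [a pa] [b pb] /= e; exact/eq_exist. Qed.

Lemma pf_val_cls a : pf_cls (pf_val a) = i.
Proof. exact: (svalP a). Qed.

Lemma pf_val_same a b : dot (pf_val a) (pf_val b) = pf_val a.
Proof. by have /pf_clsE[] : pf_cls (pf_val a) = pf_cls (pf_val b) by rewrite !pf_val_cls. Qed.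

Definition pf_fibre_matrix (F : set A) : matrix S :=
  @Matrix S pf_fibre_alg [set a | F (pf_val a)].

End Fibre.

Section Transition.
Variables (i j : pf_semilattice) (ij : sle i j).

Lemma pf_tr_subproof (a : pf_fibre i) : pf_cls (dot (sval a) (repr j)) = j.
Proof. by rewrite pf_cls_dot (svalP a) pf_reprK. Qed.

(** Any element of the class [j] in place of [repr j] defines the same map, since
    [a.r = a.(r.r') = a.(r'.r) = a.r']. *)
Definition pf_tr (a : pf_fibre i) : pf_fibre j := exist _ _ (pf_tr_subproof a).

Lemma pf_tr_hom : @hom S (pf_fibre_alg i) (pf_fibre_alg j) pf_tr.
Proof. by move=> s a; apply: pf_val_inj; rewrite /pf_val /= (pf_opl P). Qed.

End Transition.

Variable F : set A.
Hypothesis F_dot : forall a b, F a -> F (dot a b).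

Lemma pf_tr_filter (i j : pf_semilattice) (ij : sle i j) :
  (pf_tr ij : pf_fibre_alg i -> pf_fibre_alg j) @` filter_of (pf_fibre_matrix i F)
    `<=` filter_of (pf_fibre_matrix j F).
Proof. by move=> _ [a Fa <-]; exact: F_dot. Qed.

Lemma pf_tr_id (i : pf_semilattice) (ii : sle i i) a : pf_tr ii a = a.
Proof.
apply: pf_val_inj; exact: (pf_val_same a (exist _ (repr i) (pf_reprK i))).
Qed.

Lemma pf_tr_comp (i j k : pf_semilattice) (ij : sle i j) (jk : sle j k) (ik : sle i k) a :
  pf_tr ik a = pf_tr jk (pf_tr ij a).
Proof.
apply: pf_val_inj; rewrite /pf_val /=.
have /pf_sleE e : @sle pf_semilattice (pf_cls (repr j)) (pf_cls (repr k)).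
  by rewrite !pf_reprK.
by rewrite -(pf_assoc P) (pf_comm P) e.
Qed.

Definition pf_system : directed_system S :=
  @DirectedSystem S pf_semilattice (fun i => pf_fibre_matrix i F) pf_tr
    pf_tr_hom pf_tr_filter pf_tr_id pf_tr_comp.

(** Each element is tagged with its own class. Operations agree because multiplying all arguments by
    a representative of the class of the result does not change the result. *)
Lemma pf_system_iso : matrix_iso (@Matrix S A F) (plonka pf_system).
Proof.
pose f (a : A) : plonka pf_system :=
  existT (fun i => fibre pf_system i) (pf_cls a) (exist _ a erefl).
pose g (x : plonka pf_system) : A := pf_val (projT2 x).
have fK : cancel f g by [].
have gK : cancel g f.
  by move=> [i [a e]]; rewrite /f /g /pf_val /=; case: _ / e.
exists f; split; [|by exists g|by []].
move=> s a; apply: (can_inj gK); rewrite fK /g /= /pf_val /=.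
rewrite -[RHS](pf_opl P) -pf_cls_op; symmetry; apply/pf_sleE.
by rewrite pf_reprK; exact: pf_joinxx.
Qed.

End PartitionFunction.

(** With all variables identified, the inconsistency terms evaluate in the image of [M], hence in
    the filter of [N]. They entail a fresh variable, which may take any value [b]. *)
Lemma trivial_matrix_up (S : signature) (L : logic S) (Sigma : set (form S))
    (M N : matrix S) (h : M -> N) :
  inconsistency_terms L Sigma -> model L N -> hom h ->
  h @` filter_of M `<=` filter_of N -> trivial_matrix M -> trivial_matrix N.
Proof.
move=> inc LN hh hF triv; apply/seteqP; split=> // b _.
have [a] := carrier_inhabited M.
pose v n := if n is 0 then h a else b.
have hs := eval_hom (fun _ => Var 0 : Fm S).
apply: (LN _ _ (inc _ hs (Var 1)) _ (eval_hom v)) => _ [_ [phi _ <-] <-].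
rewrite eval_subst; apply: hF; exists (eval (fun _ => a) phi); first by rewrite triv.
by rewrite (eval_comp hh).
Qed.

(** * Transfer of the partition function to the left companion, and models on fibres *)

Section LogicWithPartitionFunction.
Variables (S : signature) (L : logic S) (pi : form S).

Definition dotp {A : algebra S} (a b : A) : A := eval (val2 a b) pi.

Definition fdot (t u : form S) : form S := @dotp (Fm S) t u.

Lemma eval_fdot (A : algebra S) (v : nat -> A) t u :
  eval v (fdot t u) = dotp (eval v t) (eval v u).
Proof. by rewrite /fdot /dotp eval_subst val2_comp. Qed.

Lemma eval_foldl_fdot (A : algebra S) (v : nat -> A) t r :
  eval v (foldl fdot t r) = foldl dotp (eval v t) (map (eval v) r).
Proof. by elim: r t => //= u r IH t; rewrite IH eval_fdot. Qed.

Lemma dotp_hom (A B : algebra S) (h : A -> B) : hom h -> {morph h : a b / dotp a b}.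
Proof. by move=> hh a b; exact: eval_val2_comp. Qed.

Hypothesis pi_vars : vars pi = [set 0; 1].
Hypothesis pi_entails : L [set Var 0] pi.
Hypothesis pi_partition : forall A : algebra S, Alg L A ->
  partition_function (@dotp A).

Lemma vars_fdot t u : vars (fdot t u) = vars t `|` vars u.
Proof.
rewrite /fdot /dotp (vars_subst (eval_hom (val2 t u : nat -> Fm S))) pi_vars.
by rewrite bigcup_setU !bigcup_set1.
Qed.

Lemma vars_foldl_fdot (T : Type) t (f : T -> form S) (r : seq T) :
  vars (foldl fdot t (map f r)) = vars t `|` \big[setU/set0]_(k <- r) vars (f k).
Proof.
elim: r t => [|k r IH] t /=; first by rewrite big_nil setU0.
by rewrite IH vars_fdot big_cons setUA.
Qed.

Lemma entails_fdot t u : L [set t] (fdot t u).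
Proof.
have := entails_subst (eval_hom (val2 t u : nat -> Fm S)) pi_entails.
by rewrite image_set1.
Qed.

Lemma model_dotp (M : matrix S) : model (lcomp L) M ->
  forall a b : M, filter_of M a -> filter_of M (dotp a b).
Proof.
move=> LM a b Fa; apply: (LM [set Var 0] pi _ _ (eval_hom (val2 a b))).
  exists [set Var 0]; split=> //; rewrite bigcup_set1 pi_vars => x /= ->; by left.
by move=> _ [_ -> <-].
Qed.

Let idv (A : algebra S) (a b c : A) (n : nat) : A := nth a [:: a; b; c] n.

(** All the defining identities are regular. [id3] handles those in at most three variables; in the
    other two, variables below the arity stand for the arguments and the variable [arity s] for
    [b]. *)
Lemma lcomp_partition (A : algebra S) : Alg (lcomp L) A -> partition_function (@dotp A).
Proof.
move=> LA.
have id3 t u : vars t = vars u ->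
    (forall B, Alg L B -> forall a b c : B, eval (idv a b c) t = eval (idv a b c) u) ->
    vars t `<=` [set 0; 1; 2] ->
    forall a b c : A, eval (idv a b c) t = eval (idv a b c) u.
  move=> tu val t3 a b c; apply: (regular_identity LA tu) => B LB v.
  have e w : vars w `<=` [set 0; 1; 2] -> eval v w = eval (idv (v 0) (v 1) (v 2)) w.
    by move=> w3; apply: eval_ext => x /w3 [[] /= ->|/= ->].
  by rewrite !e -?tu//; exact: val.
pose v (s : S) (a : 'I_(arity s) -> A) b x := if x < arity s then a (inord x) else b.
have vE s a b (k : 'I_(arity s)) : v s a b k = a k by rewrite /v ltn_ord inord_val.
have v_arity s a b : v s a b (arity s) = b by rewrite /v ltnn.
split.
- move=> a; have := id3 (fdot (Var 0) (Var 0)) (Var 0) _ _ _ a a a.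
  rewrite !eval_fdot; apply.
  + by rewrite vars_fdot setUid.
  + by move=> B LB ? ? ?; rewrite !eval_fdot (pf_idem (pi_partition LB)).
  + by rewrite vars_fdot => x /= [] ->; do 2 left.
- move=> a b c.
  have := id3 (fdot (Var 0) (fdot (Var 1) (Var 2))) (fdot (fdot (Var 0) (Var 1)) (Var 2))
    _ _ _ a b c.
  rewrite !eval_fdot; apply.
  + by rewrite !vars_fdot setUA.
  + by move=> B LB ? ? ?; rewrite !eval_fdot (pf_assoc (pi_partition LB)).
  + by rewrite !vars_fdot setUA.
- move=> a b c.
  have := id3 (fdot (Var 0) (fdot (Var 1) (Var 2))) (fdot (Var 0) (fdot (Var 2) (Var 1)))
    _ _ _ a b c.
  rewrite !eval_fdot; apply.
  + by rewrite !vars_fdot (setUC (vars (Var 1))).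
  + by move=> B LB ? ? ?; rewrite !eval_fdot (pf_comm (pi_partition LB)).
  + by rewrite !vars_fdot setUA.
- move=> s a b.
  have [va vb] := (vE s a b, v_arity s a b).
  have := @regular_identity _ _ _ (fdot (App s (fun k => Var k)) (Var (arity s)))
    (App s (fun k => fdot (Var k) (Var (arity s)))) LA _ _ (v s a b).
  rewrite /= !eval_fdot /= (_ : (fun k : 'I_(arity s) => v s a b k) = a) ?vb; last exact: funext.
  rewrite (_ : (fun k : 'I_(arity s) => eval (v s a b) _) = (fun k => dotp (a k) b)).
    apply.
    + rewrite vars_fdot; apply/seteqP; split=> [x [[k _ /= ->]|/= ->]|x [k _]].
      * by exists k => //; rewrite vars_fdot; left.
      * by exists ord0 => //; rewrite vars_fdot; right.
      * by rewrite vars_fdot => -[/= ->|/= ->]; [left; exists k|right].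
    + move=> B LB w; rewrite /= !eval_fdot /= (pf_opl (pi_partition LB)).
      by congr (op B s _); apply: funext => k; rewrite eval_fdot.
  by apply: funext => k; rewrite eval_fdot /= va vb.
- move=> s a b.
  have [va vb] := (vE s a b, v_arity s a b).
  have := @regular_identity _ _ _ (fdot (Var (arity s)) (App s (fun k => Var k)))
    (foldl fdot (Var (arity s)) [seq Var k | k : 'I_(arity s)]) LA _ _ (v s a b).
  rewrite eval_foldl_fdot !eval_fdot /= (_ : (fun k : 'I_(arity s) => v s a b k) = a) ?vb;
    last exact: funext.
  rewrite -map_comp (_ : [seq _ | _ <- _] = [seq a k | k : 'I_(arity s)]); last first.
    by apply: eq_map => k /=; exact: va.
  apply.
  + rewrite vars_fdot /image_mem vars_foldl_fdot; congr (_ `|` _).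
    rewrite -bigcup_seq; apply/seteqP; split=> x [k /= _ kx]; exists k => //=.
    by rewrite mem_enum.
  + move=> B LB w; rewrite eval_foldl_fdot !eval_fdot /= (pf_opr (pi_partition LB)).
    by rewrite /image_mem -map_comp.
Qed.

Lemma entails_foldl_fdot t r : L [set t] (foldl fdot t r).
Proof.
elim: r t => [|u r IH] t /=; first exact: entails_refl.
by apply: entails_cut (IH _) => _ ->; exact: entails_fdot.
Qed.

(* Multiplying the conclusion by the finitely many premises used puts their
   variables into it. *)
Lemma lcomp_absorb_premises : finitary L -> forall Gamma phi, L Gamma phi ->
  exists2 psi, lcomp L Gamma psi & forall B : algebra S,
    (forall a b : B, dotp a b = a) -> forall v : nat -> B, eval v psi = eval v phi.
Proof.
move=> fin Gamma phi /fin[D [DG Dfin Dphi]].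
have /(@finite_seqP {classic form S})[r rE] := Dfin.
exists (foldl fdot phi r).
  exists D; split=> //.
    rewrite -(map_id r) vars_foldl_fdot -(@bigcup_seq {classic form S}) -rE.
    by move=> x; right.
  by apply: entails_cut (entails_foldl_fdot _ _) => _ ->.
move=> B left_zero v; rewrite eval_foldl_fdot.
by elim: (r : seq (form S)) (eval v phi) => //= u r' IH b; rewrite IH left_zero.
Qed.

(** On a fibre the partition function is the first projection, so [phi] has the same value as the
    formula [psi] that the left companion derives from the same premises. *)
Lemma pf_fibre_model (A : algebra S) (P : partition_function (@dotp A)) (G : set A)
    (i : pf_index (@dotp A)) :
  finitary L -> model (lcomp L) (@Matrix S A G) -> model L (pf_fibre_matrix P i G).
Proof.
move=> fin LG Gamma phi GLphi h hh hG.
have [psi Gpsi psiE] := lcomp_absorb_premises fin GLphi.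
have left_zero (a b : pf_fibre_alg P i) : dotp a b = a.
  by apply: pf_val_inj; rewrite (dotp_hom (@pf_val_hom _ _ _ P i)); exact: pf_val_same.
rewrite (hom_eval hh) -(psiE _ left_zero) -(hom_eval hh).
apply: (LG Gamma psi Gpsi (@pf_val _ _ _ P i \o h)).
  by move=> s a /=; rewrite hh (@pf_val_hom _ _ _ P i).
by move=> _ [g Gg <-]; apply: hG; exists g.
Qed.

(** * Equivalence formulas, reduced fibres and both directions of the characterisation *)

Section Equivalential.
Variable Delta : set (form S).
Hypothesis Delta_vars : forall delta, Delta delta -> vars delta `<=` [set 0; 1].
Hypothesis Delta_leibniz : forall M : matrix S, model L M -> forall a b : M,
  leibniz (filter_of M) a b <-> eval (val2 a b) @` Delta `<=` filter_of M.

(* The value of [delta] at [d, d.b] equals its value at [d.b, d.b] if the second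
   variable occurs in [delta], and its value at [d, d] otherwise. *)
Lemma Mod_star_left_zero (M : matrix S) : Mod_star L M -> forall a b : M, dotp a b = a.
Proof.
move=> LM d b; have [mod red] := LM.
have P := pi_partition (Mod_star_Alg LM).
have dd c delta : Delta delta -> filter_of M (eval (val2 c c) delta).
  move=> Dd; have /(Delta_leibniz mod) := leibniz_refl (filter_of M) c.
  by apply; exists delta.
symmetry; apply/red/(Delta_leibniz mod) => _ [delta Dd <-].
have [d1|d1] := pselect (vars delta 1).
  rewrite -(pf_absorb P (val2 d (dotp d b)) d1) /=.
  rewrite (eval_val2_comp (pf_hom P (dotp d b))) (pf_assoc P) !(pf_idem P).
  exact: dd.
rewrite (@eval_ext _ _ _ (val2 d d)); first exact: dd.
by move=> x dx; case: (Delta_vars Dd dx) => /= xE; move: dx; rewrite xE.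
Qed.

Hypothesis L_finitary : finitary L.
Variable Sigma : set (form S).
Hypothesis L_inconsistency : inconsistency_terms L Sigma.

Section Decomposition.
Variables (A : algebra S) (P : partition_function (@dotp A)) (G : set A).
Hypothesis LG : model (lcomp L) (@Matrix S A G).

Lemma pf_fibre_leibniz (i : pf_index (@dotp A)) (x y : pf_fibre_matrix P i G) :
  leibniz (filter_of (pf_fibre_matrix P i G)) x y <->
  eval (val2 (pf_val x) (pf_val y)) @` Delta `<=` G.
Proof.
have mod := pf_fibre_model (P := P) (i := i) L_finitary LG.
split=> [/(Delta_leibniz mod) D _ [delta Dd <-]|D].
  rewrite -(eval_val2_comp (@pf_val_hom _ _ _ P i)); apply: D.
  by exists delta.
apply/(Delta_leibniz mod) => _ [delta Dd <-] /=.
by rewrite (eval_val2_comp (@pf_val_hom _ _ _ P i)); apply: D; exists delta.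
Qed.

(* In a larger fibre [j] the pair becomes [a.r, b.r] with [r] in [j], and
   [Delta(a.r, b.r) = Delta(a, b).r] is still in the filter. *)
Lemma same_leibniz a b : pf_cls (@dotp A) a = pf_cls (@dotp A) b ->
  eval (val2 a b) @` Delta `<=` G -> leibniz G a b.
Proof.
move=> eab Dab.
apply: (@leibniz_max _ _ _ (fun a b => pf_cls (@dotp A) a = pf_cls (@dotp A) b /\
  eval (val2 a b) @` Delta `<=` G)); last by [].
  (* Within one fibre the relation is the Leibniz congruence of that fibre, from which the
     equivalence laws are inherited. *)
  split=> [c|c d [e D]|c d f [e D] [e' D']|s c d cd].
  - split=> //; pose x : pf_fibre_matrix P _ G := exist _ c erefl.
    by apply/(pf_fibre_leibniz x x); exact: leibniz_refl.
  - split=> //; pose x : pf_fibre_matrix P _ G := exist _ c e.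
    pose y : pf_fibre_matrix P _ G := exist _ d erefl.
    by apply/(pf_fibre_leibniz y x)/leibniz_sym/pf_fibre_leibniz.
  - split; first by rewrite e.
    pose x : pf_fibre_matrix P _ G := exist _ c e.
    pose y : pf_fibre_matrix P _ G := exist _ d erefl.
    pose z : pf_fibre_matrix P _ G := exist _ f (esym e').
    apply/(pf_fibre_leibniz x z); apply: (@leibniz_trans _ _ _ _ y);
      exact/pf_fibre_leibniz.
  - have e : pf_cls (@dotp A) (op A s c) = pf_cls (@dotp A) (op A s d).
      rewrite !(pf_cls_op P); congr (@joins (pf_semilattice P) _ _).
      by apply: funext => k /=; have [] := cd k.
    split=> //; set j := pf_cls _ (op A s c) in e.
    have top (b' : 'I_(arity s) -> A) k : pf_cls (@dotp A) (op A s b') = j ->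
        pf_cls (@dotp A) (dotp (b' k) (repr j)) = j.
      move=> <-; rewrite (pf_cls_dot P) pf_reprK.
      exact: (iffRL (pf_sleE P _ _) (pf_op_arg P b' k)).
    pose x k : pf_fibre_matrix P j G := exist _ _ (top c k erefl).
    pose y k : pf_fibre_matrix P j G := exist _ _ (top d k (esym e)).
    have xy k : leibniz (filter_of (pf_fibre_matrix P j G)) (x k) (y k).
      apply/pf_fibre_leibniz => _ [delta Dd <-]; rewrite /pf_val /=.
      rewrite -(eval_val2_comp (pf_hom P (repr j))).
      apply: (model_dotp LG (repr j)).
      by have [_] := cd k; apply; exists delta.
    have /pf_fibre_leibniz := leibniz_op xy.
    rewrite !(@pf_val_hom _ _ _ P j).
    rewrite (_ : op A s (_ \o x) = op A s c); last exact: (pf_op_top P c).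
    rewrite (_ : op A s (_ \o y) = op A s d) //.
    by rewrite -[RHS](pf_op_top P d) -e.
move=> c d [e D]; pose x : pf_fibre_matrix P _ G := exist _ c e.
pose y : pf_fibre_matrix P _ G := exist _ d erefl.
exact: (leibniz_compatible (iffRL (pf_fibre_leibniz x y) D)).
Qed.

End Decomposition.

Lemma Mod_Su_plonka (M : matrix S) : Mod_Su (lcomp L) M ->
  exists X : directed_system S,
    [/\ forall i : X, Mod_star L (fibre X i),
        forall i j : X, trivial_matrix (fibre X i) -> trivial_matrix (fibre X j) -> i = j
      & matrix_iso M (plonka X)].
Proof.
case: M => A F LM; have [LF red] := LM.
have P : partition_function (@dotp A).
  by apply: lcomp_partition; exists F.
pose X := @pf_system _ _ _ P F (@model_dotp _ LF).
have LX (i : X) : model L (fibre X i) := pf_fibre_model (P := P) L_finitary LF.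
exists X; split; last exact: pf_system_iso.
  move=> i; split=> // x y; split=> [/(pf_fibre_leibniz (P := P) LF) D|->]; last first.
    exact: leibniz_refl.
  (* Values of [Delta] in [F] stay in every larger filter [G], so the pair is Suszko congruent. *)
  apply: pf_val_inj; apply/red => G LG FG; apply: (same_leibniz P LG).
    by rewrite !pf_val_cls.
  by move=> a /D /FG.
move=> i j ti tj.
have tr_triv (k l : X) : sle k l -> trivial_matrix (fibre X k) -> trivial_matrix (fibre X l).
  move=> kl; apply: (trivial_matrix_up L_inconsistency (LX l) (tr_hom kl)).
  exact: tr_filter.
pose triv a := trivial_matrix (fibre X (pf_cls (@dotp A) a)).
have trivF a : triv a -> F a.
  by move=> /seteqP[_ /(_ (exist _ a erefl))]; exact.
have triv_op (s : S) (a : 'I_(arity s) -> A) k : triv (a k) -> triv (op A s a).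
  by apply: tr_triv; apply/pf_sleE; exact: pf_op_arg.
have ij : suszko (lcomp L) F (repr i) (repr j).
  move=> G LG FG.
  (* An operation with an argument in a trivial fibre has its value in a trivial fibre, so this is a
     congruence; trivial fibres lie within [F], hence within [G]. *)
  apply: (@leibniz_max _ _ _ (fun a b => a = b \/ triv a /\ triv b)).
  - split=> [a|a b|a b c|s a b ab]; first by left.
    + by case=> [->|[]]; [left|right].
    + by case=> [->//|[ta tb]] [<-|[_ tc]]; right.
    + have [[k tk]|nt] := pselect (exists k, triv (a k) /\ triv (b k)).
        by right; split; apply: (triv_op _ _ k); case: tk.
      left; congr (op A s _); apply: funext => k; case: (ab k) => // tk.
      by case: nt; exists k.
  - by move=> a b [<-//|[_ tb]] _; exact/FG/trivF.
  - by right; rewrite /triv !pf_reprK.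
by rewrite -(pf_reprK i) -(pf_reprK j) (iffLR (red _ _) ij).
Qed.

Lemma plonka_Mod_Su (X : directed_system S) :
  (forall i : X, Mod_star L (fibre X i)) ->
  (forall i j : X, trivial_matrix (fibre X i) -> trivial_matrix (fibre X j) -> i = j) ->
  Mod_Su (lcomp L) (plonka X).
Proof.
move=> LX triv.
have eta_model (N : matrix S) : model L N -> model L (@Matrix S N (filter_of N)) by case: N.
have LF : model (lcomp L) (plonka X).
  apply: (plonka_model (G := fun i => filter_of (fibre X i))) => [i j ij a Fa|i].
    exact: tr_mem.
  exact/eta_model/(LX i).1.
split=> // a b; split=> [|->]; last by move=> G _ _; exact: leibniz_refl.
have lower (i j : X) (x : fibre X i) (y : fibre X j) :
    suszko (lcomp L) (filter_of (plonka X)) (plonka_in x) (plonka_in y) ->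
    ~ sle j i -> trivial_matrix (fibre X i).
  move=> xy ji; apply/seteqP; split=> // c _.
  pose G k : set (fibre X k) := [set z | sle j k \/ filter_of (fibre X k) z].
  have LG : model (lcomp L) (@Matrix S (plonka_alg X) [set u | G (projT1 u) (projT2 u)]).
    apply: (plonka_model (G := G)) => [k l kl z [jk|Fz]|k].
    - by left; exact: sle_trans jk kl.
    - by right; exact: tr_mem.
    - have [jk|jk] := pselect (sle j k); first by move=> Gamma phi _ h _ _; left.
      rewrite (_ : G k = filter_of (fibre X k)); first exact/eta_model/(LX k).1.
      by apply/seteqP; split=> z; [case|right].
  have Gxy := xy _ LG (fun u Fu => or_intror Fu).
  have : leibniz [set u : plonka X | G (projT1 u) (projT2 u)]
      (dotp (plonka_in c) (plonka_in x)) (dotp (plonka_in c) (plonka_in y)).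
    by apply: leibniz_eval; case=> [|n]; [exact: leibniz_refl|exact: Gxy].
  (* Now [c.x = c], while [c.y] lies in a fibre above [j] and so in the enlarged filter.
     Compatibility puts [c] there too, and since [j] is not below [i], into the original filter. *)
  rewrite -(dotp_hom (@plonka_in_hom _ X i) c x) (Mod_star_left_zero (LX i)).
  move=> /leibniz_sym cy.
  have jd : sle j (projT1 (dotp (plonka_in c) (plonka_in y))).
    have := @plonka_eval_ge _ X (val2 (plonka_in c) (plonka_in y)) pi 1; apply.
    by rewrite pi_vars; right.
  by case: (leibniz_compatible cy (or_introl jd)).
case: a b => [i x] [j y] xy.
have suszko_sym (u w : plonka X) :
    suszko (lcomp L) (filter_of (plonka X)) u w -> suszko (lcomp L) (filter_of (plonka X)) w u.
  by move=> uw G LG FG; exact/leibniz_sym/uw.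
have le (k l : X) (z : fibre X k) (w : fibre X l) :
    suszko (lcomp L) (filter_of (plonka X)) (plonka_in z) (plonka_in w) -> sle l k.
  (* If [l] is not below [k], the fibre [k] is trivial. So is the fibre [l], along the transition
     map if [k] is below [l] and by symmetry otherwise; uniqueness then gives [k = l]. *)
  move=> zw; apply: contrapT => lk.
  have tk := lower _ _ _ _ zw lk.
  suff tl : trivial_matrix (fibre X l) by apply: lk; rewrite (triv _ _ tk tl); exact: sle_refl.
  have [kl|kl] := pselect (sle k l); last exact: lower (suszko_sym _ _ zw) kl.
  exact: (trivial_matrix_up L_inconsistency (LX l).1 (tr_hom kl) (@tr_filter _ _ _ _ kl)).
have ij : i = j by apply: sle_anti; [exact: le (suszko_sym _ _ xy)|exact: le xy].
case: _ / ij in y xy *; congr existT; apply/(LX i).2.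
(* The filter of the sum is itself one of those intersected, and it restricts to the filter of the
   fibre [i]. *)
exact: leibniz_preimage (@plonka_in_hom _ X i) (xy _ LF (fun _ => id)).
Qed.

End Equivalential.

End LogicWithPartitionFunction.

Theorem theorem5p12 (S : signature) (L : logic S)
    (L_finitary : finitary L) (L_equivalential : equivalential L)
    (L_partition : has_partition_function L)
    (L_inconsistency : exists Sigma : set (form S), inconsistency_terms L Sigma)
    (M : matrix S) :
  Mod_Su (lcomp L) M <->
  exists X : directed_system S,
    [/\ forall i : X, Mod_star L (fibre X i),
        forall i j : X, trivial_matrix (fibre X i) -> trivial_matrix (fibre X j) -> i = j
      & matrix_iso M (plonka X)].
Proof.
have [Delta [Delta_vars Delta_leibniz]] := L_equivalential.
have [pi [pi_vars pi_entails pi_partition]] := L_partition.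
have [Sigma inc] := L_inconsistency.
split=> [LM|[X [LX triv iso]]].
  exact: (Mod_Su_plonka pi_vars pi_entails pi_partition Delta_leibniz L_finitary inc LM).
apply: matrix_iso_Mod_Su iso _.
exact: (plonka_Mod_Su pi_vars pi_partition Delta_vars Delta_leibniz inc LX triv).
Qed.
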